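(* There is an absolute constant $C_\beta$ such that every finite multigraph $G$ with $\beta(G)\ge 2$ satisfies $$\operatorname{bn}(G)\le C_\beta\log\beta(G).$$
   Context: Multigraphs may have loops and parallel edges; a loop contributes two to the degree of its incident vertex. $\log$ is the base-$2$ logarithm. For a finite multigraph $G=(V,E)$, the cycle space $\mathcal Z(G)\subseteq\mathbb F_2^{E}$ is the vector space of Eulerian edge sets (edge sets in which every vertex has even degree), with symmetric difference as addition. The cycle rank is $\beta(G)=\dim_{\mathbb F_2}\mathcal Z(G)=|E(G)|-|V(G)|+c(G)$, where $c(G)$ is the number of connected components. A cycle basis of $G$ is a basis of $\mathcal Z(G)$ over $\mathbb F_2$. For a family $\mathcal B$ of edge sets and $e\in E$, the charge of $e$ is $\operatorname{ch}_{\mathcal B}(e)=|\{B\in\mathcal B: e\in B\}|$, and the congestion of $\mathcal B$ is $\operatorname{cong}(\mathcal B)=\max_{e\in E}\operatorname{ch}_{\mathcal B}(e)$, with $\operatorname{cong}(\mathcal B)=0$ if $E=\varnothing$. The basis number of $G$ is $\operatorname{bn}(G)=\min\{\operatorname{cong}(\mathcal B):\mathcal B\text{ is a cycle basis of }G\}$. *)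

(* Defs.v *)
From HB Require Import structures.
From mathcomp Require Import all_boot all_order all_algebra.
From mathcomp Require Import reals exp.
Set Implicit Arguments.
Unset Strict Implicit.
Unset Printing Implicit Defensive.
Import Order.TTheory GRing.Theory Num.Theory.
Local Open Scope ring_scope.

(* The ends of an edge are stored as an ordered pair; every notion below is
   symmetric in the two components, so the order carries no information.
   Loops have equal components, and parallel edges are distinct elements of
   [edge G] with the same ends. *)
Record multigraph := Multigraph {
  vert : finType;
  edge : finType;
  ends : edge -> vert * vert
}.

Section EdgeSpace.
Variable E : finType.

(* F_2^E.  The regular algebra ('F_2)^o is 'F_2 seen as a module over itself. *)
Definition edge_space := {ffun E -> ('F_2)^o}.

Definition chi (A : {set E}) : edge_space := [ffun e => (e \in A)%:R].

Definition supp (x : edge_space) : {set E} := [set e | x e != 0].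

Lemma F2_bool (a : 'F_2) : a = (a != 0)%:R.
Proof. by apply/val_inj; case: a => [[|[|]]]. Qed.

Lemma suppK : cancel supp chi.
Proof. by move=> x; apply/ffunP=> e; rewrite ffunE inE -F2_bool. Qed.

Lemma chiK : cancel chi supp.
Proof. by move=> A; apply/setP=> e; rewrite inE ffunE; case: (e \in A). Qed.

Lemma chiD (A A' : {set E}) : chi A + chi A' = chi ((A :\: A') :|: (A' :\: A)).
Proof.
apply/ffunP=> e; rewrite !ffunE !inE.
by case: (e \in A); case: (e \in A'); apply/val_inj.
Qed.

Definition charge (B : {set {set E}}) (e : E) : nat :=
  #|[set A in B | e \in A]|.

Definition congestion (B : {set {set E}}) : nat :=
  (\max_(e : E) charge B e)%N.

End EdgeSpace.

Section CycleSpace.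
Variable G : multigraph.

Definition incidence (v : vert G) (e : edge G) : nat :=
  (((ends e).1 == v) + ((ends e).2 == v))%N.

Definition degree (A : {set edge G}) (v : vert G) : nat :=
  (\sum_(e in A) incidence v e)%N.

Definition eulerian (A : {set edge G}) : bool :=
  [forall v, ~~ odd (degree A v)].

(* The library's subspaces are built from generators; [mem_cycle_space] shows
   that the span adds nothing to the set of Eulerian edge sets. *)
Definition cycle_space : {vspace edge_space (edge G)} :=
  <<[seq chi A | A : {set edge G} in eulerian]>>%VS.

Definition cycle_rank : nat := \dim cycle_space.

Definition cycle_basis (B : {set {set edge G}}) : bool :=
  basis_of cycle_space [seq chi A | A in B].

Lemma eulerianP (x : edge_space (edge G)) :
  reflect (forall v, \sum_e (x e : 'F_2) * (incidence v e)%:R = 0)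
          (eulerian (supp x)).
Proof.
have degE v : (degree (supp x) v)%:R
    = \sum_e (x e : 'F_2) * (incidence v e)%:R :> 'F_2.
  rewrite /degree natr_sum big_mkcond; apply: eq_bigr => e _.
  rewrite inE [in RHS](F2_bool (x e)).
  by case: (x e != 0); rewrite ?mul1r ?mul0r.
have oddE n : ~~ odd n = (n%:R == 0 :> 'F_2).
  by rewrite -dvdn2 (dvdn_pcharf (pchar_Fp (isT : prime 2))).
apply: (iffP forallP) => H v; first by apply/eqP; rewrite -degE -oddE.
by rewrite oddE degE H.
Qed.

Lemma mem_cycle_space (x : edge_space (edge G)) :
  (x \in cycle_space) = eulerian (supp x).
Proof.
apply/idP/idP => [|Ex]; last first.
  by apply: memv_span; apply/imageP; exists (supp x); rewrite ?suppK.
move/(coord_span (X := in_tuple _)) ->; apply/eulerianP => v.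
under eq_bigr => e _ do rewrite sum_ffunE mulr_suml.
rewrite exchange_big big1 //= => i _.
have /imageP[A ES ->] :
    [seq chi A | A : {set edge G} in eulerian]`_i
      \in [seq chi A | A : {set edge G} in eulerian] by apply: mem_nth.
under eq_bigr => e _ do rewrite ffunE -[_ *: _]/(_ * _) -mulrA.
rewrite -mulr_sumr.
by have /eulerianP -> : eulerian (supp (chi A)); rewrite ?chiK ?mulr0.
Qed.

Lemma cycle_basis_exists :
  exists n, [exists B, cycle_basis B && (congestion B == n)].
Proof.
pose B := [set A in map (@supp _) (vbasis cycle_space)].
exists (congestion B); apply/existsP; exists B; rewrite eqxx andbT.
have Bu : uniq (map (@supp _) (vbasis cycle_space)).
  rewrite (map_inj_uniq (can_inj (@suppK _))).
  exact: free_uniq (basis_free (vbasisP _)).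
rewrite /cycle_basis (@perm_basis _ _ _ (vbasis cycle_space)) ?vbasisP //.
rewrite -[X in perm_eq _ X](mapK (@suppK (edge G))); apply: perm_map.
by apply: uniq_perm; rewrite ?enum_uniq // => A; rewrite mem_enum inE.
Qed.

Definition basis_number : nat := ex_minn cycle_basis_exists.

End CycleSpace.

Definition log2 (R : realType) (x : R) : R := ln x / ln 2.

(* Main.v *)
Require Import Defs.
From HB Require Import structures.
From mathcomp Require Import all_boot all_order all_algebra.
From mathcomp Require Import ring lra zify.
From mathcomp Require Import reals sequences exp.
Import Order.TTheory GRing.Theory Num.Theory.
Local Open Scope ring_scope.

(** The cycle basis is obtained by rounding a random one.

A random basis with small expected charges. Let b be the cycle rank. Up to
suppressing vertices of degree 2, a graph with a cycle has minimum degree 3 and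
at most 2b vertices, so by the Moore bound it has a cycle C with O(log b) edges.
Delete a random edge of C, find a random basis of the cycle space of the rest,
and add C to it. Every time an edge is charged, it is deleted with probability at
least 1 / O(log b), so its expected charge is O(log b)
([fractional_cycle_basis]). Suppression is not carried out: edges are counted up
to belonging to the same cycles ([trace]), and the Moore bound is proved directly
for this count ([short_cycle]). Paths are replaced by edge sets with a prescribed
boundary; if there are no short cycles, the edges inside a ball are independent
vectors in a space whose dimension is smaller than the number of vertices of the
ball ([inside_lt]), so balls are forests and grow exponentially
([reach_growth]).

Rounding. With independent choices, the maximum charge over the edges could
exceed the expectations by a logarithmic factor. Instead, the distribution is
regarded as a point x of the base polytope of the linear matroid of all cycles,
and swap rounding is applied: two bases with weights are merged by symmetric
exchanges, and of the two possible directions of an exchange one does not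
increase the potential, which is the sum over the edges of the products of
1 + x C over the cycles C through the edge ([merge_bases]). At a basis, the
potential is the sum of 2 to the charges; at x it is at most the number of edges
times exp (O(log b)). It suffices to sum over one edge of each class, and there
are at most 7b classes ([traces_count]). Hence 2 to the maximum charge is
polynomial in b, and the maximum charge is O(log b). *)

Set Implicit Arguments.
Unset Strict Implicit.
Unset Printing Implicit Defensive.

(** * Bases indexed by a finite set and symmetric exchange *)

Section IndexedBases.
Variables (K : fieldType) (vT : vectType K) (I : finType) (f : I -> vT).
Implicit Types (U : {vspace vT}) (B : {set I}) (i j : I).

Definition indexed_basis U B := basis_of U [seq f i | i in B].

Lemma perm_image_setU1 i B : i \notin B ->
  perm_eq [seq f j | j in i |: B] (f i :: [seq f j | j in B]).
Proof.
move=> iB; rewrite -[_ :: _]/(map f (i :: enum B)); apply/perm_map/uniq_perm.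
- exact: enum_uniq.
- by rewrite /= mem_enum iB enum_uniq.
- by move=> j; rewrite mem_enum !inE mem_enum.
Qed.

Lemma size_indexed_basis U B : indexed_basis U B -> #|B| = \dim U.
Proof.
by move=> bB; rewrite (@size_basis _ _ U _ (in_tuple _) bB) size_image.
Qed.

Lemma span_image_sum B v : v \in <<[seq f i | i in B]>>%VS ->
  exists2 a : I -> K, forall i, i \notin B -> a i = 0
                    & v = \sum_i a i *: f i.
Proof.
rewrite span_def big_image => /memv_sumP[vs vsP ->].
have P i : exists a : K, (i \in B -> vs i = a *: f i) /\ (i \notin B -> a = 0).
  case iB: (i \in B); last by exists 0.
  by have /vlineP[a ->] := vsP i iB; exists a.
have [a aP] := fin_all_exists P.
exists a => [i|]; first by case: (aP i).
rewrite [LHS]big_mkcond; apply: eq_bigr => i _.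
by case: ifP => iB; [apply: (aP i).1|rewrite (aP i).2 ?scale0r ?iB].
Qed.

Lemma indexed_basisU1 U B i : i \notin B -> free [seq f j | j in B] ->
    f i \notin <<[seq f j | j in B]>>%VS -> f i \in U ->
    (<<[seq f j | j in B]>> <= U)%VS -> (\dim U <= #|B|.+1)%N ->
  indexed_basis U (i |: B).
Proof.
move=> iB frB fiB fiU sBU dU; rewrite /indexed_basis.
rewrite (perm_basis _ (perm_image_setU1 iB)) basisEfree free_cons fiB frB /=.
by rewrite span_cons subv_add -memvE fiU sBU /= size_image.
Qed.

Lemma indexed_basisD1 U B i : indexed_basis U B -> i \in B ->
  [/\ f i \in U, f i \notin <<[seq f j | j in B :\ i]>>%VS,
      free [seq f j | j in B :\ i] & (<<[seq f j | j in B :\ i]>> <= U)%VS].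
Proof.
move=> bB iB; have niB : i \notin B :\ i by rewrite !inE eqxx.
have := perm_image_setU1 niB; rewrite setD1K // => pB.
move: (bB); rewrite /indexed_basis (perm_basis _ pB) => bB'.
have := basis_free bB'; rewrite free_cons => /andP[-> ->]; split => //.
  by rewrite (basis_mem bB') ?inE ?eqxx.
by rewrite -(span_basis bB') span_cons addvSr.
Qed.

Lemma indexed_basis_swap U B i j : indexed_basis U B -> i \in B -> j \notin B ->
    f j \in U -> f j \notin <<[seq f k | k in B :\ i]>>%VS ->
  indexed_basis U (j |: B :\ i).
Proof.
move=> bB iB jB fjU fjB; have [_ _ frB sBU] := indexed_basisD1 bB iB.
apply: indexed_basisU1 => //; first by rewrite !inE negb_and jB orbT.
by rewrite -(size_indexed_basis bB) (cardsD1 i B) iB.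
Qed.

(** Some f j in the expansion of f i over the second basis lies outside the
hyperplane spanned by the first basis without i, since f i itself does; that j
can be exchanged with i in both bases at once. *)
Lemma symmetric_exchange U B1 B2 i :
    indexed_basis U B1 -> indexed_basis U B2 -> i \in B1 -> i \notin B2 ->
  exists j, [/\ j \in B2, j \notin B1,
    indexed_basis U (j |: B1 :\ i) & indexed_basis U (i |: B2 :\ j)].
Proof.
move=> b1 b2 i1 i2; have [fiU fiN _ _] := indexed_basisD1 b1 i1.
set H := <<_>>%VS in fiN.
have [j /and3P[j2 jH jN]|no_j] :=
  pickP [pred j | [&& j \in B2, f j \notin H &
                   f i \notin <<[seq f k | k in B2 :\ j]>>%VS]].
  have fjU : f j \in U by have [] := indexed_basisD1 b2 j2.
  have j1 : j \notin B1.
    apply: contra jH => j1; apply/memv_span/imageP; exists j => //.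
    by rewrite !inE j1 andbT; apply: contraNneq i2 => <-.
  by exists j; split=> //; apply: indexed_basis_swap.
have: f i \in <<[seq f k | k in B2]>>%VS by rewrite (span_basis b2).
case/span_image_sum=> a a0 def_fi; case/negP: fiN; rewrite def_fi.
apply: memv_suml => j _.
have [->|aj] := eqVneq (a j) 0; first by rewrite scale0r mem0v.
have j2 : j \in B2 by apply: contraNT aj => /a0->.
apply: memvZ; apply/negPn/negP => jH.
have := no_j j; rewrite /= j2 jH /= => /negbFE iB.
have [_ /negP fjN _ _] := indexed_basisD1 b2 j2; apply: fjN.
have ->: f j = (a j)^-1 *: (f i - \sum_(k | k != j) a k *: f k).
  by rewrite def_fi (bigD1 j) //= addrK scalerA mulVf ?scale1r.
apply/memvZ/memvB; first exact: iB; apply: memv_suml => k kj.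
have [->|ak] := eqVneq (a k) 0; first by rewrite scale0r mem0v.
apply/memvZ/memv_span/imageP; exists k => //; rewrite !inE kj.
by apply: contraNT ak => /a0->.
Qed.

End IndexedBases.

(** * Swap rounding *)

Section Rounding.
Variables (R : realFieldType) (I : finType) (N : {set {set I}}).

(** A multilinear relaxation of an exponential moment: at the indicator of B the
term of t is two to the power of the number of elements of B in t. *)
Definition potential (x : I -> R) : R :=
  \sum_(t in N) \prod_(i in t) (1 + x i).

Lemma eq_potential x y : x =1 y -> potential x = potential y.
Proof.
by move=> xy; apply: eq_bigr => t _; apply: eq_bigr => i _; rewrite xy.
Qed.

(** Along the direction that moves weight from i to j, each product in the
potential is affine if it contains at most one of the two factors, and otherwise
a quadratic with leading coefficient at most 0. So the potential at x is at least
the weighted mean of its values at x1 and x2, the two ends of a segment through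
x. *)
Lemma potential_swap_concave (x x1 x2 : I -> R) (i j : I) (a b : R) :
    i != j -> 0 <= a -> 0 <= b -> (forall k, 0 <= x k) ->
    (forall k, k != i -> k != j -> x1 k = x k /\ x2 k = x k) ->
    x1 i = x i - a -> x1 j = x j + a -> x2 i = x i + b -> x2 j = x j - b ->
  b * potential x1 + a * potential x2 <= (a + b) * potential x.
Proof.
move=> ij a0 b0 x0 xk x1i x1j x2i x2j; rewrite /potential !mulr_sumr -big_split.
apply: ler_sum => t _ /=.
have split3 (y : I -> R) : \prod_(k in t) (1 + y k) =
    (if i \in t then 1 + y i else 1) * (if j \in t then 1 + y j else 1) *
    \prod_(k in t | (k != i) && (k != j)) (1 + y k).
  rewrite big_mkcond (bigD1 i) //=.
  rewrite (bigD1 j) 1?eq_sym //= mulrA; congr (_ * _).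
  by rewrite -big_mkcondl; apply: eq_bigl => k; rewrite andbC.
rewrite !split3.
have rest y : (forall k, k != i -> k != j -> y k = x k) ->
    \prod_(k in t | (k != i) && (k != j)) (1 + y k) =
    \prod_(k in t | (k != i) && (k != j)) (1 + x k).
  by move=> yx; apply: eq_bigr => k /and3P[_ ki kj]; rewrite yx.
rewrite (rest x1) => [|k ki kj]; last by case: (xk k ki kj).
rewrite (rest x2) => [|k ki kj]; last by case: (xk k ki kj).
set P := \prod_(k in t | _) _; have P0 : 0 <= P.
  by apply: prodr_ge0 => k _; rewrite addr_ge0.
rewrite !mulrA -!mulrDl ler_wpM2r // x1i x1j x2i x2j.
have ab0 : 0 <= a * b * (a + b) by rewrite !mulr_ge0 ?addr_ge0.
by case: (i \in t); case: (j \in t); nra.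
Qed.

Variables (K : fieldType) (vT : vectType K) (f : I -> vT).
Implicit Types (U : {vspace vT}) (B : {set I}).

Definition indic B : I -> R := fun i => (i \in B)%:R.

(** Pairwise step of swap rounding. By symmetric exchange, either basis can be
moved one element towards the other; the two moves shift the weights in opposite
directions, so by concavity one of them does not increase the potential. The
background weight z is whatever the rest of a larger combination contributes. *)
Lemma merge_bases U B1 B2 (a b : R) (z : I -> R) :
    indexed_basis f U B1 -> indexed_basis f U B2 ->
    0 <= a -> 0 <= b -> (forall i, 0 <= z i) ->
  exists2 B, indexed_basis f U B &
    potential (fun i => (a + b) * indic B i + z i)
      <= potential (fun i => a * indic B1 i + b * indic B2 i + z i).
Proof.
move=> b1 b2 a0 b0 z0; have [n] := ubnP #|B1 :\: B2|.
elim: n B1 B2 b1 b2 => // n IHn B1 B2 b1 b2 lt_n.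
have [sB12|] := boolP (B1 \subset B2).
  have eB : B1 = B2.
    apply/eqP; rewrite eqEcard sB12.
    by rewrite (size_indexed_basis b1) (size_indexed_basis b2) leqnn.
  exists B2 => //; rewrite le_eqVlt; apply/orP; left; apply/eqP/eq_potential.
  by move=> i; rewrite eB mulrDl.
case/subsetPn => i i1 i2; have [j [j2 j1 b1' b2']] := symmetric_exchange b1 b2 i1 i2.
have ij : i != j by apply: contraNneq i2 => ->.
pose F C1 C2 := potential (fun k => a * indic C1 k + b * indic C2 k + z k).
have Fcc : b * F (j |: B1 :\ i) B2 + a * F B1 (i |: B2 :\ j) <= (a + b) * F B1 B2.
  apply: (potential_swap_concave ij) => //.
  - by move=> k; rewrite !addr_ge0 // mulr_ge0 ?ler0n.
  - by move=> k /negPf ki /negPf kj; rewrite /indic !inE ki kj.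
  - by rewrite /indic !inE eqxx i1 (negPf i2) (negPf ij) /=; lra.
  - by rewrite /indic !inE eqxx (negPf j1) j2 /=; lra.
  - by rewrite /indic !inE eqxx i1 (negPf i2) /=; lra.
  - by rewrite /indic !inE eqxx (negPf j1) j2 eq_sym (negPf ij) /=; lra.
have lt1 : (#|(j |: B1 :\ i) :\: B2| < n)%N.
  apply: leq_trans (_ : _ <= #|B1 :\: B2|)%N lt_n; apply: proper_card; apply/properP; split.
    by apply/subsetP=> k; rewrite !inE; have [->|] := eqVneq k j;
      rewrite ?j2 //= => _ /and3P[-> _ ->].
  by exists i; rewrite !inE ?i1 ?i2 ?eqxx //= (negPf ij).
have lt2 : (#|B1 :\: (i |: B2 :\ j)| < n)%N.
  apply: leq_trans (_ : _ <= #|B1 :\: B2|)%N lt_n; apply: proper_card; apply/properP; split.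
    apply/subsetP=> k; rewrite !inE => /andP[+ k1]; rewrite k1 andbT.
    case/norP=> _; rewrite negb_and negbK => /orP[/eqP kj|//].
    by rewrite kj (negPf j1) in k1.
  by exists i; rewrite !inE ?i1 ?i2 ?eqxx.
have [le1|gt1] := lerP (F (j |: B1 :\ i) B2) (F B1 B2).
  by have [B bB leB] := IHn _ _ b1' b2 lt1; exists B => //; apply: le_trans leB le1.
have [le2|gt2] := lerP (F B1 (i |: B2 :\ j)) (F B1 B2).
  by have [B bB leB] := IHn _ _ b1 b2' lt2; exists B => //; apply: le_trans leB le2.
have [/eqP|ab] := eqVneq (a + b) 0.
  rewrite paddr_eq0 // => /andP[/eqP az /eqP bz]; exists B1 => //.
  rewrite le_eqVlt; apply/orP; left; apply/eqP/eq_potential=> k.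
  by rewrite az bz !(mul0r, add0r).
suff: (a + b) * F B1 B2 < (a + b) * F B1 B2 by rewrite ltxx.
apply: lt_le_trans Fcc.
have [bz|bn0] := eqVneq b 0.
  have ap : 0 < a by rewrite lt_neqAle a0 eq_sym -[a]addr0 -[X in a + X]bz ab.
  by rewrite bz addr0 mul0r add0r ltr_pM2l.
have bp : 0 < b by rewrite lt_neqAle b0 eq_sym bn0.
rewrite [ltLHS]mulrDl addrC ltr_leD ?ltr_pM2l // ler_wpM2l //; exact: ltW.
Qed.

(** What is needed of a convex combination of bases. Quantifying over the scale w
and the background z makes the property stable under averaging and under
enlarging the space, so that no explicit combination has to be recorded. *)
Definition rounds U (x : I -> R) := forall (w : R) (z : I -> R),
  0 <= w -> (forall i, 0 <= z i) ->
  exists2 B, indexed_basis f U B &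
    potential (fun i => w * indic B i + z i)
      <= potential (fun i => w * x i + z i).

Lemma rounds_indic U B : indexed_basis f U B -> rounds U (indic B).
Proof. by move=> bB w z _ _; exists B. Qed.

(** The points are rounded one after another, each against the background of the
others, and the resulting bases are merged. *)
Lemma rounds_sum (J : eqType) (s : seq J) U (x : J -> I -> R) B0 w z :
    indexed_basis f U B0 -> 0 <= w -> (forall i, 0 <= z i) ->
    (forall j i, j \in s -> 0 <= x j i) ->
    (forall j, j \in s -> rounds U (x j)) ->
  exists2 B, indexed_basis f U B &
    potential (fun i => w * (size s)%:R * indic B i + z i)
      <= potential (fun i => w * (\sum_(j <- s) x j i) + z i).
Proof.
move=> bB0 w0; elim: s z => [|j s IHs] z z0 x0 xR.
  exists B0 => //; rewrite le_eqVlt; apply/orP; left; apply/eqP/eq_potential.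
  by move=> i; rewrite !big_nil !(mulr0, mul0r).
have js : j \in j :: s by rewrite inE eqxx.
have [i|l i ls|l ls|B1 b1 le1] := IHs (fun i => w * x j i + z i).
- by rewrite addr_ge0 // mulr_ge0 ?x0.
- by apply: x0; rewrite inE ls orbT.
- by apply: xR; rewrite inE ls orbT.
have sw0 : 0 <= w * (size s)%:R by rewrite mulr_ge0.
have [//|i|B2 b2 le2] := xR j js w (fun i => w * (size s)%:R * indic B1 i + z i).
  by rewrite addr_ge0 // mulr_ge0 ?ler0n.
have [B bB leB] := merge_bases b2 b1 w0 sw0 z0.
exists B => //.
rewrite (_ : potential _ =
    potential (fun i => (w + w * (size s)%:R) * indic B i + z i)); last first.
  by apply: eq_potential => i; rewrite -[size (j :: s)]add1n natrD mulrDr mulr1.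
apply: le_trans leB _.
rewrite (_ : potential _ = potential (fun i => w * indic B2 i +
   (w * (size s)%:R * indic B1 i + z i))); last first.
  by apply: eq_potential => i; rewrite addrA.
apply: le_trans le2 _.
rewrite (_ : potential _ = potential (fun i => w * (size s)%:R * indic B1 i +
   (w * x j i + z i))); last by apply: eq_potential => i; rewrite addrCA.
apply: le_trans le1 _; rewrite le_eqVlt; apply/orP; left; apply/eqP/eq_potential.
by move=> i; rewrite big_cons mulrDr addrCA addrA.
Qed.

Lemma rounds_average (J : eqType) (s : seq J) U (x : J -> I -> R) :
    (0 < size s)%N ->
    (forall j i, j \in s -> 0 <= x j i) ->
    (forall j, j \in s -> rounds U (x j)) ->
  rounds U (fun i => (size s)%:R^-1 * \sum_(j <- s) x j i).
Proof.
move=> s0 x0 xR w z w0 z0.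
have [B0 b0] : exists B0, indexed_basis f U B0.
  case: s s0 x0 xR => // j s _ x0 xR.
  have [||//|B b _] := xR j _ 0 (fun=> 0); first by rewrite inE eqxx.
    by [].
  by exists B.
have sn0 : (size s)%:R != 0 :> R by rewrite pnatr_eq0 -lt0n.
have ws0 : 0 <= w / (size s)%:R by rewrite divr_ge0.
have [B bB leB] := rounds_sum b0 ws0 z0 x0 xR; exists B => //.
rewrite (_ : potential _ = potential (fun i =>
  w / (size s)%:R * (size s)%:R * indic B i + z i)); last first.
  by apply: eq_potential => i; rewrite divfK.
apply: le_trans leB _; rewrite le_eqVlt; apply/orP; left; apply/eqP/eq_potential.
by move=> i; rewrite mulrA.
Qed.

(** The new element can be put into the background. *)
Lemma rounds_setU1 U U' (i0 : I) (x : I -> R) :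
    rounds U x ->
    (forall B, indexed_basis f U B -> i0 \notin B /\ indexed_basis f U' (i0 |: B)) ->
  rounds U' (fun i => x i + indic [set i0] i).
Proof.
move=> xR ext w z w0 z0.
have [//|i|B bB leB] := xR w (fun i => w * indic [set i0] i + z i).
  by rewrite addr_ge0 // mulr_ge0 ?ler0n.
have [iB bB'] := ext B bB; exists (i0 |: B) => //.
rewrite (_ : potential _ = potential (fun i =>
  w * indic B i + (w * indic [set i0] i + z i))); last first.
  apply: eq_potential => i; rewrite addrA -mulrDr /indic !inE.
  by have [->|] := eqVneq i i0; rewrite ?(negPf iB) ?add0r ?addr0.
apply: le_trans leB _; rewrite le_eqVlt; apply/orP; left; apply/eqP/eq_potential.
by move=> i; rewrite addrA -mulrDr.
Qed.

End Rounding.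

(** * Vectors over the field with two elements *)

Section EdgeVectors.
Variable E : finType.
Implicit Types (x y : edge_space E) (X Y : {set E}).

Lemma F2_odd n : (n%:R : 'F_2) = (odd n)%:R.
Proof.
rewrite -[in LHS](odd_double_half n) natrD -muln2 natrM.
by rewrite (_ : 2%:R = 0 :> 'F_2) ?mulr0 ?addr0 //; apply/val_inj.
Qed.

Lemma F2_addxx (a : 'F_2) : a + a = 0.
Proof. by rewrite -mulr2n -mulr_natr (F2_odd 2) mulr0. Qed.

Lemma ffunF2_addxx (T : finType) (x : {ffun T -> ('F_2)^o}) : x + x = 0.
Proof. by apply/ffunP=> e; rewrite !ffunE F2_addxx. Qed.

Lemma supp_add x y : supp (x + y) \subset supp x :|: supp y.
Proof.
apply/subsetP=> e; rewrite !inE ffunE; apply: contraNT; rewrite negb_or !negbK.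
by case/andP=> /eqP-> /eqP->; rewrite addr0.
Qed.

Lemma supp0 : supp (0 : edge_space E) = set0.
Proof. by apply/setP=> e; rewrite !inE ffunE eqxx. Qed.

Lemma chi_sum X : chi X = \sum_(e in X) chi [set e].
Proof.
apply/ffunP=> e; rewrite sum_ffunE !ffunE.
under eq_bigr => i _ do rewrite ffunE inE.
case eX: (e \in X).
  rewrite (bigD1 e) //= eqxx big1 ?addr0 // => i /andP[_ ie].
  by rewrite eq_sym (negPf ie).
by rewrite big1 // => i iX; case: eqP => // ei; rewrite ei iX in eX.
Qed.

Definition coord_space X := <<[seq chi [set e] | e in X]>>%VS.

Lemma mem_coord_space X x : (x \in coord_space X) = (supp x \subset X).
Proof.
apply/idP/idP => [|sX].
  case/span_image_sum=> a a0 ->; apply/subsetP=> e; rewrite inE sum_ffunE.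
  apply: contraR => eX; rewrite big1 // => i _; rewrite !ffunE inE.
  by case: eqP => [<-|_]; rewrite ?(a0 e eX) ?scale0r ?scaler0.
rewrite -[x]suppK chi_sum; apply: memv_suml => e ex.
by apply/memv_span/imageP; exists e => //; apply: (subsetP sX).
Qed.

Lemma dual_free (J : finType) (S : {set J}) (y : J -> edge_space E) (a : J -> E) :
    (forall p q, p \in S -> q \in S -> y p (a q) = (p == q)%:R) ->
  free [seq y p | p in S].
Proof.
have [n] := ubnP #|S|; elim: n S => // n IHn S ltS dual.
have [->|[p pS]] := set_0Vmem S.
  by rewrite (_ : [seq _ | _ in _] = [::]) ?nil_free // /image_mem enum_set0.
have pS' : p \notin S :\ p by rewrite !inE eqxx.
rewrite -(setD1K pS) (perm_free (perm_image_setU1 y pS')) free_cons IHn ?andbT.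
- apply/negP; case/span_image_sum=> c c0 /ffunP/(_ (a p)).
  rewrite dual // eqxx sum_ffunE big1 => [/eqP|q _]; first by rewrite oner_eq0.
  rewrite ffunE; have [qS|/c0->] := boolP (q \in S :\ p); last by rewrite scale0r.
  by case/setD1P: qS => qp qS; rewrite dual // (negPf qp) scaler0.
- by rewrite (cardsD1 p) pS in ltS.
- by move=> q q' /setD1P[_ qS] /setD1P[_ qS']; apply: dual.
Qed.

(** A family in which every vector has a private coordinate is independent. *)
Lemma dual_card (J : finType) (S : {set J}) (y : J -> edge_space E) (a : J -> E)
    (U : {vspace edge_space E}) :
    (forall p q, p \in S -> q \in S -> y p (a q) = (p == q)%:R) ->
    (forall p, p \in S -> y p \in U) ->
  (#|S| <= \dim U)%N.
Proof.
move=> dual yU; have/eqP := dual_free dual.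
rewrite size_image => <-; apply: dimvS; apply/span_subvP => _ /imageP[p pS ->].
exact: yU.
Qed.

Lemma chi1_dual (X : {set E}) : forall p q, p \in X -> q \in X ->
  chi [set p] q = (p == q)%:R :> 'F_2.
Proof. by move=> p q _ _; rewrite ffunE inE eq_sym. Qed.

End EdgeVectors.

(** * Cycle spaces, series classes and degrees *)

Section Cycles.
Variable G : multigraph.
Notation E := (edge G).
Notation V := (vert G).

Definition vertex_space := {ffun V -> ('F_2)^o}.

Definition bd (x : edge_space E) : vertex_space :=
  [ffun v => \sum_e (x e : 'F_2) * (incidence v e)%:R].

Definition vtx (v : V) : vertex_space := [ffun u => (u == v)%:R].

Fact bd_is_linear : linear bd.
Proof.
move=> a x y; apply/ffunP=> v; rewrite !ffunE.
transitivity (\sum_e (a * ((x e : 'F_2) * (incidence v e)%:R)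
                      + (y e : 'F_2) * (incidence v e)%:R)).
  by apply: eq_bigr => e _; rewrite !ffunE mulrDl mulrA.
by rewrite big_split -mulr_sumr.
Qed.
HB.instance Definition _ :=
  GRing.isLinear.Build 'F_2 (edge_space E) vertex_space _ bd bd_is_linear.

Lemma eulerian_bd x : eulerian (supp x) = (bd x == 0).
Proof.
apply/eulerianP/eqP => [bd0|/ffunP bd0 v].
  by apply/ffunP=> v; rewrite !ffunE bd0.
by have := bd0 v; rewrite !ffunE.
Qed.

Lemma odd_incidence v (e : E) :
  odd (incidence v e) = ((ends e).1 == v) (+) ((ends e).2 == v).
Proof. by rewrite /incidence; case: eqP; case: eqP. Qed.

Lemma bd_chi (X : {set E}) v :
  bd (chi X) v = (odd #|[set e in X | odd (incidence v e)]|)%:R.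
Proof.
rewrite ffunE -F2_odd -sum1dep_card natr_sum [RHS]big_mkcond.
apply: eq_bigr => e _; rewrite ffunE [in LHS]F2_odd.
by case: (e \in X); case: odd; rewrite ?mulr1 ?mulr0 ?mul0r.
Qed.

Lemma bd_chi1 e : bd (chi [set e]) = vtx (ends e).1 + vtx (ends e).2.
Proof.
apply/ffunP=> v; rewrite ffunE (bigD1 e) //= big1 => [|i ie]; last first.
  by rewrite ffunE inE (negPf ie) mul0r.
rewrite !ffunE inE eqxx mul1r addr0 /incidence natrD.
by rewrite ![v == _]eq_sym.
Qed.

Definition cycles (A : {set E}) : {set {set E}} :=
  [set C : {set E} | eulerian C & C \subset A].

Definition cycle_subspace (A : {set E}) : {vspace edge_space E} :=
  (cycle_space G :&: coord_space A)%VS.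

Lemma mem_cycle_subspace A x : (x \in cycle_subspace A) = (supp x \in cycles A).
Proof. by rewrite memv_cap mem_cycle_space mem_coord_space inE. Qed.

Lemma chi_cycle_subspace A C : (chi C \in cycle_subspace A) = (C \in cycles A).
Proof. by rewrite mem_cycle_subspace chiK. Qed.

Lemma cycle_subspaceT : cycle_subspace setT = cycle_space G.
Proof.
apply/vspaceP=> x; rewrite mem_cycle_subspace mem_cycle_space inE.
by rewrite subsetT andbT.
Qed.

(** This set determines, and is determined by, the functional that the edge e
defines on the cycle space. Edges in series, such as the pieces of a subdivided
edge, have the same trace, so counting edges by traces has the effect of
suppressing the vertices of degree 2, without changing the graph. *)
Definition trace A (e : E) : {set {set E}} := [set C in cycles A | e \in C].

Lemma in_trace A e C : (C \in trace A e) = (C \in cycles A) && (e \in C).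
Proof. by rewrite [LHS]inE. Qed.

Section Support.
Variable A : {set E}.
Notation tr := (trace A).
Implicit Types (C X : {set E}) (e f : E) (v : V).

Definition core : {set E} := \bigcup_(C in cycles A) C.

Lemma core_sub : core \subset A.
Proof. by apply/bigcupsP=> C; rewrite inE => /andP[]. Qed.

Lemma cycle_core C : C \in cycles A -> C \subset core.
Proof. by move=> CA; apply: bigcup_sup. Qed.

Lemma eq_traceP e f :
  reflect (forall C, C \in cycles A -> (e \in C) = (f \in C)) (tr e == tr f).
Proof.
apply: (iffP eqP) => [/setP tef C CA|ef]; first by have := tef C; rewrite !in_trace CA.
by apply/setP=> C; rewrite !in_trace; apply: andb_id2l => CA; rewrite ef.
Qed.

(** Odd incidence excludes the loops, which do not affect parities of degrees. *)
Definition star (v : V) : {set E} := [set e in core | odd (incidence v e)].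

Lemma star_core v : star v \subset core.
Proof. by apply/subsetP=> e; rewrite inE => /andP[]. Qed.

Lemma bd_star (X : {set E}) v :
  X \subset core -> bd (chi X) v = (odd #|X :&: star v|)%:R.
Proof.
move=> XK; rewrite bd_chi; congr (odd _)%:R; apply: eq_card => e; rewrite !inE.
by apply: andb_id2l => /(subsetP XK)->.
Qed.

Lemma cycle_star_even C v : C \in cycles A -> ~~ odd #|C :&: star v|.
Proof.
move=> CA; have CK := cycle_core CA; move: CA.
rewrite inE -{1}[C]chiK eulerian_bd => /andP[/eqP/ffunP/(_ v) + _].
by rewrite (bd_star v CK) ffunE; case: odd => // /eqP; rewrite oner_eq0.
Qed.

Lemma eulerian_star C : C \subset core ->
  (forall v, ~~ odd #|C :&: star v|) -> C \in cycles A.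
Proof.
move=> CK ev; rewrite inE (subset_trans CK core_sub) andbT -[C]chiK eulerian_bd.
by apply/eqP/ffunP=> v; rewrite (bd_star v CK) ffunE (negPf (ev v)).
Qed.

Lemma star_gt1 v e : e \in star v -> (1 < #|star v|)%N.
Proof.
move=> ev; have /bigcupP[C CA eC] := subsetP (star_core v) e ev.
have: (0 < #|C :&: star v|)%N by apply/card_gt0P; exists e; rewrite inE eC.
have := subset_leq_card (subsetIr C (star v)).
have := cycle_star_even v CA; case: #|C :&: star v| => [|[|n]] //= _ ln _.
exact: leq_trans ln.
Qed.

(** A cycle has even degree at v, so it takes both edges at a vertex of degree 2
or none. *)
Lemma trace_star2 v e f :
  #|star v| = 2%N -> e \in star v -> f \in star v -> tr e = tr f.
Proof.
move=> s2 ev fv; apply/eqP/eq_traceP=> C CA.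
suff sub a b : a \in star v -> b \in star v -> a \in C -> b \in C.
  by apply/idP/idP; apply: sub.
move=> av bv aC; have: (0 < #|C :&: star v|)%N.
  by apply/card_gt0P; exists a; rewrite inE aC.
have sI := subsetIr C (star v); have := subset_leq_card sI.
have := cycle_star_even v CA; rewrite s2 => ev1 le2 gt0.
have/eqP/esym eI : C :&: star v == star v.
  by rewrite eqEcard sI s2; move: ev1 le2 gt0; case: #|_| => [|[|[]]].
by move: bv; rewrite eI inE => /andP[].
Qed.

Definition series_class (t : {set {set E}}) : {set E} := [set f in core | tr f == t].

Lemma in_series_class t f :
  (f \in series_class t) = (f \in core) && (tr f == t).
Proof. by rewrite [LHS]inE. Qed.

(** At a vertex of degree 2, both edges or neither belong to the class. Such a
class is the edge set of a loop or of a component of the core that is a cycle. *)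
Lemma series_class_cycle t :
    (forall v, series_class t :&: star v != set0 -> (#|star v| <= 2)%N) ->
  series_class t \in cycles A.
Proof.
move=> le2; apply: eulerian_star => [|v].
  by apply/subsetP=> f; rewrite inE => /andP[].
have [->|ne] := eqVneq (series_class t :&: star v) set0; first by rewrite cards0.
have le := le2 v ne; have /set0Pn[f] := ne; rewrite inE => /andP[ft fv].
have s2 : #|star v| = 2%N by apply/eqP; rewrite eqn_leq le (star_gt1 fv).
rewrite (setIidPr _) ?s2 //; apply/subsetP=> g gv; move: ft.
by rewrite !inE (trace_star2 s2 gv fv) => /andP[_ ->]; rewrite (subsetP (star_core v)).
Qed.

Definition nonloops : {set E} := [set e in core | (ends e).1 != (ends e).2].
Definition inside (Y : {set V}) : {set E} :=
  [set e in nonloops | ((ends e).1 \in Y) && ((ends e).2 \in Y)].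
Definition touching (Y : {set V}) : {set E} :=
  [set e in nonloops | ((ends e).1 \in Y) || ((ends e).2 \in Y)].

Lemma in_inside (Y : {set V}) e : (e \in inside Y) =
  (e \in nonloops) && (((ends e).1 \in Y) && ((ends e).2 \in Y)).
Proof. by rewrite [LHS]inE. Qed.

Lemma in_touching (Y : {set V}) e : (e \in touching Y) =
  (e \in nonloops) && (((ends e).1 \in Y) || ((ends e).2 \in Y)).
Proof. by rewrite [LHS]inE. Qed.

Definition touched : {set V} := [set v | star v != set0].
Definition branch : {set V} := [set v | 2 < #|star v|]%N.

Lemma in_star v e : (e \in star v) =
  (e \in nonloops) && (((ends e).1 == v) || ((ends e).2 == v)).
Proof.
rewrite !inE odd_incidence -andbA; congr (_ && _).
case: (eqVneq (ends e).1 v) => [<-|n1]; first by rewrite eq_sym andbT.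
by case: (eqVneq (ends e).2 v) => [->|]; rewrite ?n1 ?andbF.
Qed.

Lemma handshake (Y : {set V}) :
  (\sum_(v in Y) #|star v| = #|touching Y| + #|inside Y|)%N.
Proof.
transitivity (\sum_(e in nonloops) (((ends e).1 \in Y) + ((ends e).2 \in Y)))%N.
  under eq_bigr => v _ do rewrite -sum1_card (eq_bigl _ _ (in_star v)) big_mkcondr.
  rewrite exchange_big; apply: eq_bigr => e /setIdP[_ ne] /=.
  have one u : ((u \in Y) = \sum_(v in Y) (u == v) :> nat)%N.
    have [uY|uY] := boolP (u \in Y).
      rewrite (bigD1 u) //= eqxx big1 ?addn0 // => v /andP[_ vu].
      by rewrite eq_sym (negPf vu).
    by rewrite big1 // => v vY; case: eqP => // uv; rewrite uv vY in uY.
  rewrite !one -big_split; apply: eq_bigr => v _ /=.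
  have [ev|_] := eqVneq (ends e).1 v; last by case: (_ == v).
  by rewrite -ev eq_sym (negPf ne).
have card_sub (P : pred E) :
    #|[set e in nonloops | P e]| = (\sum_(e in nonloops) P e)%N.
  by rewrite -sum1dep_card big_mkcondr; apply: eq_bigr => e _; case: (P e).
rewrite /touching /inside !card_sub -big_split; apply: eq_bigr => e _ /=.
by do 2!case: (_ \in Y).
Qed.

(** Rank-nullity for the boundary map on the edge sets without loops, whose image
is supported on the touched vertices. *)
Lemma nonloops_dim : (#|nonloops| <= \dim (cycle_subspace A) + #|touched|)%N.
Proof.
pose U := coord_space nonloops.
have dU : \dim U = #|nonloops|.
  by rewrite (eqnP (dual_free (chi1_dual (X := nonloops)))) size_image.
rewrite -dU -(limg_ker_dim (linfun bd) U); apply: leq_add.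
  apply/dimvS/subvP=> x; rewrite memv_cap memv_ker lfunE /= mem_coord_space.
  case/andP=> sx bx; rewrite mem_cycle_subspace inE eulerian_bd bx /=.
  by apply: subset_trans sx (subset_trans _ core_sub); apply/subsetP=> e /setIdP[].
apply: leq_trans (_ : \dim <<[seq vtx v | v in touched]>>%VS <= _)%N; last first.
  by rewrite (leq_trans (dim_span _)) ?size_image.
apply/dimvS/subvP=> _ /memv_imgP[x xU ->]; rewrite lfunE /=.
have sx : supp x \subset core.
  move: xU; rewrite mem_coord_space => /subset_trans-> //.
  by apply/subsetP=> e /setIdP[].
have -> : bd x = \sum_v (bd x v) *: vtx v.
  apply/ffunP=> u; rewrite sum_ffunE (bigD1 u) //= big1 ?addr0 => [|v vu].
    by rewrite !ffunE eqxx [RHS]mulr1.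
  by rewrite !ffunE eq_sym (negPf vu) scaler0.
apply: memv_suml => v _; have [vT|vT] := boolP (v \in touched).
  by apply/memvZ/memv_span/imageP; exists v.
move: vT; rewrite inE negbK => /eqP v0.
by rewrite -[x]suppK (bd_star v sx) v0 setI0 cards0 scale0r mem0v.
Qed.

Lemma branch_touched : branch \subset touched.
Proof.
by apply/subsetP=> v; rewrite !inE -card_gt0 => /ltnW/ltnW.
Qed.

Lemma touched_split : #|touched| = (#|branch| + #|[set v | #|star v| == 2]|)%N.
Proof.
rewrite -(cardsID branch) (setIidPr branch_touched); congr (_ + _)%N.
apply: eq_card => v; rewrite !inE -leqNgt; apply/andP/eqP => [[le /set0Pn[e ev]]|s2].
  by apply/eqP; rewrite eqn_leq le (star_gt1 ev).
by rewrite -card_gt0 s2.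
Qed.

Lemma star_sum : (\sum_(v in branch) #|star v| + #|[set v | #|star v| == 2]|.*2
  = #|nonloops|.*2)%N.
Proof.
have := handshake setT.
rewrite (_ : touching setT = nonloops); last first.
  by apply/setP=> e; rewrite !inE andbT.
rewrite (_ : inside setT = nonloops); last by apply/setP=> e; rewrite !inE /= !andbT.
rewrite addnn => <-; rewrite [RHS](bigID (mem branch)) /=; congr (_ + _)%N.
  by apply: eq_bigl => v; rewrite !inE.
rewrite [RHS](bigID (mem [set v | #|star v| == 2])) /= [X in (_ + X)%N]big1 ?addn0.
  rewrite -muln2 -sum_nat_const [RHS](eq_bigl (mem [set v | #|star v| == 2])).
    by apply: eq_bigr => v; rewrite !inE => /eqP.
  by move=> v; rewrite !inE /= andbC; case: eqP => // ->.
move=> v; rewrite !inE /= -leqNgt => /andP[le2 ne2].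
apply/eqP; rewrite -leqn0 leqNgt; apply/negP=> /card_gt0P[e /star_gt1 gt1].
by rewrite eqn_leq le2 gt1 in ne2.
Qed.

(** Subtracting two from every degree in the handshake identity leaves twice
the excess of edges over vertices, hence at most twice the dimension; a branch
vertex loses at most two thirds of its degree. *)
Lemma branch_bounds (d := \dim (cycle_subspace A)) :
  (#|branch| <= 2 * d)%N /\ (\sum_(v in branch) #|star v| <= 6 * d)%N.
Proof.
rewrite /d; have := nonloops_dim; have := star_sum; rewrite touched_split.
have: (#|branch| * 3 <= \sum_(v in branch) #|star v|)%N.
  by rewrite -sum_nat_const; apply: leq_sum => v; rewrite inE.
by split; lia.
Qed.

End Support.
End Cycles.

(** * Short cycles and the number of series classes *)

Section Growth.
Variables (G : multigraph) (A : {set edge G}).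
Notation E := (edge G).
Notation V := (vert G).
Notation tr := (trace A).
Implicit Types (X Y : {set E}) (e f : E) (u v w : V) (x y : edge_space E).

Definition classes X := #|tr @: X|.

Lemma classesS X Y : X \subset Y -> (classes X <= classes Y)%N.
Proof. by move=> XY; apply/subset_leq_card/imsetS. Qed.

Lemma classesU X Y : (classes (X :|: Y) <= classes X + classes Y)%N.
Proof. by rewrite /classes imsetU (leq_card_setU _ _).1. Qed.

Lemma classes_add x y :
  (classes (supp (x + y)%R) <= classes (supp x) + classes (supp y))%N.
Proof. exact: leq_trans (classesS (supp_add x y)) (classesU _ _). Qed.

Lemma classes1 e : classes [set e] = 1%N.
Proof. by rewrite /classes imset_set1 cards1. Qed.

Lemma star_bd v u e : e \in star A v -> e \in star A u -> u != v ->
  bd (chi [set e]) = vtx v + vtx u.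
Proof.
rewrite !in_star bd_chi1 => /andP[_ ev] /andP[_ eu] uv.
case/orP: ev => /eqP ev; case/orP: eu => /eqP eu; first 1 last.
- by rewrite ev eu.
- by rewrite ev eu addrC.
- by rewrite -eu ev eqxx in uv.
- by rewrite -eu ev eqxx in uv.
Qed.

Lemma supp_add_core x y :
  supp x \subset core A -> supp y \subset core A -> supp (x + y) \subset core A.
Proof.
by move=> sx sy; rewrite (subset_trans (supp_add x y)) // subUset sx sy.
Qed.

Variable r : V.

(** The ball of radius j about r for the length that counts classes of edges: a
path from r to v is replaced by any edge set with boundary r + v. *)
Definition reach j : {set V} :=
  [set v | [exists X : {set E}, [&& X \subset core A, (classes X <= j)%N
                                  & bd (chi X) == vtx r + vtx v]]].

Lemma reachP j v :
  reflect (exists x, [/\ supp x \subset core A, (classes (supp x) <= j)%N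
                       & bd x = vtx r + vtx v]) (v \in reach j).
Proof.
rewrite inE; apply: (iffP existsP) => [[X /and3P[XK Xj /eqP bX]]|[x [xK xj bx]]].
  by exists (chi X); rewrite chiK.
by exists (supp x); rewrite suppK xK xj bx eqxx.
Qed.

Lemma reach_mono i j : (i <= j)%N -> reach i \subset reach j.
Proof.
move=> ij; apply/subsetP=> v /reachP[x [xK xi bx]]; apply/reachP.
by exists x; rewrite (leq_trans xi).
Qed.

Lemma reach_root j : r \in reach j.
Proof.
apply/reachP; exists 0; rewrite supp0 sub0set /classes imset0 cards0 raddf0.
by rewrite ffunF2_addxx.
Qed.

Lemma reach_star j v u e :
  v \in reach j -> e \in star A v -> e \in star A u -> u \in reach j.+1.
Proof.
move=> vj ev eu; have [->|uv] := eqVneq u v.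
  exact: (subsetP (reach_mono (leqnSn j))).
have /reachP[x [xK xj bx]] := vj; apply/reachP; exists (x + chi [set e]).
split; last by rewrite raddfD /= bx (star_bd ev eu uv) addrA -(addrA (vtx r))
                 ffunF2_addxx addr0.
  by rewrite supp_add_core // chiK sub1set (subsetP (star_core _ v)).
by rewrite (leq_trans (classes_add _ _)) // chiK classes1 addn1.
Qed.

Lemma path_meets_star v x :
    v != r -> supp x \subset core A -> bd x = vtx r + vtx v ->
  exists2 f, f \in supp x & f \in star A v.
Proof.
move=> vr xK bx; have: bd x v = 1.
  by rewrite bx !ffunE (negPf vr) eqxx add0r.
rewrite -[x]suppK (bd_star v xK) suppK.
have [->|[f]] := set_0Vmem (supp x :&: star A v).
  by rewrite cards0 => /esym/eqP; rewrite oner_eq0.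
by rewrite in_setI => /andP[fx fv] _; exists f.
Qed.

(** The path into v already uses one of the two edges at v, and both edges have
the same trace, so adding the edge e does not create a new class. *)
Lemma reach_series j v u e : v \in reach j -> v != r -> #|star A v| = 2%N ->
  e \in star A v -> e \in star A u -> u \in reach j.
Proof.
move=> vj vr s2 ev eu; have [->//|uv] := eqVneq u v.
have /reachP[x [xK xj bx]] := vj; apply/reachP; exists (x + chi [set e]).
split; last by rewrite raddfD /= bx (star_bd ev eu uv) addrA -(addrA (vtx r))
                 ffunF2_addxx addr0.
  by rewrite supp_add_core // chiK sub1set (subsetP (star_core _ v)).
have [f fx fv] := path_meets_star vr xK bx.
apply: leq_trans xj; apply: leq_trans (classesS (supp_add _ _)) _.
rewrite chiK /classes imsetU imset_set1 (trace_star2 s2 ev fv).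
by rewrite setUC (setUidPr _) // sub1set imset_f.
Qed.

Variable k : nat.
Hypothesis no_short : forall C, C \in cycles A -> (classes C <= k.*2.+1)%N -> C = set0.

(** The ball induces a forest. Choose for every v in Y an edge set s v joining r
to v. An edge with ends u and v closes s u + s v to a cycle with few classes, so
that edge is s u + s v; thus the edges inside Y, which are independent vectors,
lie in the span of the s v + s r with v different from r. *)
Lemma inside_lt (Y : {set V}) :
  Y \subset reach k -> r \in Y -> (#|inside A Y| < #|Y|)%N.
Proof.
move=> Yk rY.
have /fin_all_exists[s sP] : forall v, exists x : edge_space E, v \in Y ->
    [/\ supp x \subset core A, (classes (supp x) <= k)%N & bd x = vtx r + vtx v].
  move=> v; have [vY|_] := boolP (v \in Y); last by exists 0.
  by have /reachP[x xP] := subsetP Yk v vY; exists x.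
pose y v := s v + s r.
pose U := <<[seq y v | v in Y :\ r]>>%VS.
have yU v : v \in Y -> y v \in U.
  move=> vY; have [->|vr] := eqVneq v r; first by rewrite /y ffunF2_addxx mem0v.
  by apply/memv_span/imageP; exists v; rewrite // !inE vr.
rewrite (cardsD1 r Y) rY ltnS; apply: leq_trans (_ : \dim U <= _)%N; last first.
  by rewrite (leq_trans (dim_span _)) ?size_image.
apply: (dual_card (y := fun e => chi [set e]) (a := id)) => [p q pY qY|e].
  exact: chi1_dual pY qY.
rewrite inE => /andP[/setIdP[eK _] /andP[e1 e2]].
have [s1K s1k b1] := sP _ e1; have [s2K s2k b2] := sP _ e2.
suff ->: chi [set e] = y (ends e).1 + y (ends e).2 by rewrite memvD ?yU.
have: s (ends e).1 + s (ends e).2 + chi [set e] = 0.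
  set x := _ + chi _; rewrite -[x]suppK [supp x]no_short.
  - by apply/ffunP=> f; rewrite !ffunE inE.
  - rewrite inE eulerian_bd !raddfD /=.
    rewrite b1 b2 bd_chi1 [X in X + _]addrACA ffunF2_addxx add0r ffunF2_addxx eqxx /=.
    apply: subset_trans (core_sub A).
    by rewrite !supp_add_core // chiK sub1set.
  - apply: leq_trans (classes_add _ _) _; rewrite chiK classes1 addn1 ltnS.
    by apply: leq_trans (classes_add _ _) _; rewrite -addnn leq_add.
move/(congr1 (+%R (s (ends e).1 + s (ends e).2))).
rewrite addr0 addrA ffunF2_addxx add0r => ->.
by rewrite /y addrACA ffunF2_addxx addr0.
Qed.

Hypothesis r_branch : r \in branch A.

Let b j := #|branch A :&: reach j|.

(** Let D be the vertices of degree 2 in the ball of radius j + 1, and add them to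
the ball of radius j. All edges at the resulting set Y stay inside the ball of
radius j + 1. By the forest bound for Y, the number of edges at Y is larger than
the sum over Y of (degree - 1), which is at least 2 b_j + |D|, where b_j is the
number of branch vertices in the ball of radius j. By the forest bound for
the larger ball it is smaller than b_(j+1) + |D|. *)
Lemma reach_growth j : (j < k)%N -> (2 * b j + 2 <= b j.+1)%N.
Proof.
have r3 : (2 < #|star A r|)%N by move: r_branch; rewrite inE.
move=> jk; pose D := [set v in reach j.+1 | #|star A v| == 2%N].
have inB v : (v \in branch A) = (2 < #|star A v|)%N by rewrite [LHS]inE.
have inD v : (v \in D) = (v \in reach j.+1) && (#|star A v| == 2%N).
  by rewrite [LHS]inE.
have disjD i : [disjoint branch A :&: reach i & D].
  rewrite -setI_eq0; apply/eqP/setP=> v; rewrite !in_setI in_set0 inB inD.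
  by case: eqP => [->|]; rewrite ?andbF.
have cardY i : #|(branch A :&: reach i) :|: D| = (b i + #|D|)%N.
  by apply/eqP; rewrite (leq_card_setU _ _).2 disjD.
pose Y := branch A :&: reach j :|: D.
have cover i : (i <= j.+1)%N -> reach i \subset branch A :&: reach i :|: D.
  move=> ij; apply/subsetP=> v vi; rewrite in_setU in_setI vi andbT inB inD.
  have [->|vr] := eqVneq v r; first by rewrite r3.
  have /reachP[x [xK _ bx]] := vi; have [f _ fv] := path_meets_star vr xK bx.
  rewrite orbC eqn_leq (star_gt1 fv) andbT ltnNge.
  by rewrite (subsetP (reach_mono ij)) //= orbN.
have rj : reach j \subset Y by apply: cover.
have YS : Y \subset reach j.+1.
  rewrite subUset; apply/andP; split.
    exact: subset_trans (subsetIr _ _) (reach_mono (leqnSn j)).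
  by apply/subsetP=> v; rewrite inD => /andP[].
have rS := cover _ (leqnn j.+1).
have rk := reach_mono jk.
have i1 := inside_lt rk (reach_root _).
have i2 := inside_lt (subset_trans YS rk) (subsetP rj _ (reach_root _)).
have tch : touching A Y \subset inside A (reach j.+1).
  apply/subsetP=> e; rewrite in_touching in_inside => /andP[eN]; rewrite eN /=.
  have e1s : e \in star A (ends e).1 by rewrite in_star eN eqxx.
  have e2s : e \in star A (ends e).2 by rewrite in_star eN eqxx orbT.
  have key v u : v \in Y -> e \in star A v -> e \in star A u -> u \in reach j.+1.
    move=> vY ev eu; have [vj|vj] := boolP (v \in reach j).
      exact: reach_star vj ev eu.
    have vr : v != r by apply: contraNneq vj => ->; apply: reach_root.
    move: vY; rewrite in_setU in_setI (negPf vj) andbF /= inD => /andP[vS /eqP s2].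
    exact: reach_series vS vr s2 ev eu.
  by case/orP=> eY; rewrite !(key _ _ eY).
have t1 := subset_leq_card tch.
have hs := handshake A Y.
have sumY : (3 * b j + 2 * #|D| <= \sum_(v in Y) #|star A v|)%N.
  rewrite (eq_bigl [predU branch A :&: reach j & D]) => [|v]; last first.
    by rewrite in_setU.
  rewrite bigU //= mulnC [(2 * _)%N]mulnC -!sum_nat_const leq_add //.
    by apply: leq_sum => v; rewrite in_setI inB => /andP[].
  by apply: leq_sum => v; rewrite inD => /andP[_ /eqP->].
have cY := cardY j; have cS := cardY j.+1.
have := subset_leq_card rS; rewrite cS.
rewrite -/Y in cY; lia.
Qed.

Lemma reach_exponential j : (j <= k)%N -> (2 ^ j <= b j)%N.
Proof.
elim: j => [_|j IHj jk].
  by rewrite expn0; apply/card_gt0P; exists r; rewrite in_setI r_branch reach_root.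
have := reach_growth jk; have := IHj (ltnW jk); rewrite expnS; lia.
Qed.

End Growth.

(** If no cycle is short, the number of branch vertices in the balls about a
branch vertex doubles k times and exceeds the number of all branch vertices.
Without any branch vertex, a single class is a cycle. *)
Lemma short_cycle (G : multigraph) (A : {set edge G}) (k : nat) :
    (2 * \dim (cycle_subspace A) < 2 ^ k)%N -> core A != set0 ->
  exists2 C, C \in cycles A & C != set0 /\ (classes A C <= k.*2.+1)%N.
Proof.
move=> dk /set0Pn[e eK].
have [[C /and3P[CA C0 Ck]]|no] := altP (@existsP _ (fun C : {set edge G} =>
  [&& C \in cycles A, C != set0 & (classes A C <= k.*2.+1)%N])).
  by exists C.
have no_short C : C \in cycles A -> (classes A C <= k.*2.+1)%N -> C = set0.
  move=> CA Ck; apply/eqP; apply: contraNT no => C0; apply/existsP.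
  by exists C; rewrite CA C0.
have [/eqP b0|[r rb]] := set_0Vmem (branch A); last first.
  have := reach_exponential no_short rb (leqnn k); have [+ _] := branch_bounds A.
  have := subset_leq_card (subsetIl (branch A) (reach A r k)); lia.
have cls : series_class A (trace A e) \in cycles A.
  apply: series_class_cycle => v _; rewrite leqNgt; apply/negP => v3.
  by move/eqP/setP/(_ v): b0; rewrite !inE v3.
have : series_class A (trace A e) = set0.
  apply: no_short => //; apply: leq_trans (_ : 1 <= _)%N => //.
  rewrite -(cards1 (trace A e)); apply: subset_leq_card.
  apply/subsetP => _ /imsetP[f + ->]; rewrite in_series_class => /andP[_ /eqP->].
  by rewrite set11.
by move/setP/(_ e); rewrite in_series_class eK eqxx inE.
Qed.

(** A class either contains an edge at a branch vertex, or is itself a cycle. The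
edges at branch vertices are few, and the cycles of the second kind are disjoint,
hence independent. *)
Lemma traces_count (G : multigraph) (A : {set edge G}) :
  (#|trace A @: core A| <= 7 * \dim (cycle_subspace A))%N.
Proof.
pose Q := [set t in trace A @: core A | series_class A t \in cycles A].
have Qd : (#|Q| <= \dim (cycle_subspace A))%N.
  have [->|[t0]] := set_0Vmem Q; first by rewrite cards0.
  rewrite inE => /andP[/imsetP[e0 _ _] _].
  pose a t := odflt e0 [pick f in series_class A t].
  have aP t : t \in Q -> a t \in series_class A t.
    rewrite inE => /andP[/imsetP[f fK ->] _]; rewrite /a.
    by case: pickP => // /(_ f); rewrite !inE fK eqxx.
  apply: (dual_card (y := fun t => chi (series_class A t)) (a := a)) => [t u tQ uQ|t].
    have := aP u uQ; rewrite ffunE !inE => /andP[-> /eqP->].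
    by rewrite eq_sym.
  by rewrite inE => /andP[_ tc]; rewrite chi_cycle_subspace.
pose P := \bigcup_(v in branch A) star A v.
have Pd : (#|trace A @: P| <= 6 * \dim (cycle_subspace A))%N.
  apply: leq_trans (leq_imset_card _ _) (leq_trans _ (branch_bounds A).2).
  rewrite /P; elim/big_rec2: _ => [|v n X _ leX]; first by rewrite cards0.
  by rewrite (leq_trans (leq_card_setU _ _).1) ?leq_add2l.
have sub : trace A @: core A \subset trace A @: P :|: Q.
  apply/subsetP=> t tK; rewrite in_setU; have [//|tP /=] := boolP (t \in _ @: P).
  rewrite inE tK; apply: series_class_cycle => v /set0Pn[f].
  rewrite in_setI inE => /andP[/andP[_ /eqP ft] fv]; rewrite leqNgt.
  apply: contra tP => v3; apply/imsetP; exists f => //.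
  by apply/bigcupP; exists v; rewrite // inE.
apply: leq_trans (subset_leq_card sub) (leq_trans (leq_card_setU _ _).1 _).
lia.
Qed.

(** * The fractional cycle basis *)

Section Deletion.
Variables (G : multigraph) (A : {set edge G}).
Notation E := (edge G).

Definition delete_class (t : {set {set E}}) : {set E} := [set f in A | trace A f != t].

(** Deleting all edges with the trace of e has the same effect on cycles as
deleting e. *)
Lemma cycles_delete C (e : E) : C \in cycles A -> e \in A ->
  (C \in cycles (delete_class (trace A e))) = (e \notin C).
Proof.
move=> CA eA; apply/idP/idP => [|eC].
  rewrite inE => /andP[_ /subsetP sC]; apply/negP=> /sC.
  by rewrite !inE eqxx andbF.
move: (CA); rewrite !inE => /andP[-> sC] /=; apply/subsetP=> f fC.
rewrite inE (subsetP sC) //=; apply: contra eC => /eq_traceP ef.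
by rewrite -(ef C CA).
Qed.

Lemma cycles_deleteS t : cycles (delete_class t) \subset cycles A.
Proof.
apply/subsetP=> C; rewrite !inE => /andP[->] /subset_trans-> //.
by apply/subsetP=> f /setIdP[].
Qed.

(** Adding C to a cycle that contains e gives one that avoids e, so C and the
cycles avoiding e span everything. *)
Lemma basis_delete (C : {set E}) (e : E) (B : {set {set E}}) :
    C \in cycles A -> e \in C ->
    indexed_basis (@chi E) (cycle_subspace (delete_class (trace A e))) B ->
  C \notin B /\ indexed_basis (@chi E) (cycle_subspace A) (C |: B).
Proof.
move=> CA eC bB; set A' := delete_class _ in bB.
have eA : e \in A by move: CA; rewrite inE => /andP[_ /subsetP]; apply.
have CA' : C \notin cycles A' by rewrite cycles_delete // negbK.
have sp := span_basis bB.
have CB : C \notin B.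
  apply: contra CA' => CB; rewrite -chi_cycle_subspace; apply: (basis_mem bB).
  by apply/imageP; exists C.
split=> //; apply: indexed_basisU1 => //.
- exact: basis_free bB.
- by rewrite sp chi_cycle_subspace.
- by rewrite chi_cycle_subspace.
- rewrite sp; apply/subvP=> x; rewrite !mem_cycle_subspace.
  exact: (subsetP (cycles_deleteS _)).
rewrite (size_indexed_basis bB).
have sub : (cycle_subspace A <= <[chi C]> + cycle_subspace A')%VS.
  apply/subvP=> x; rewrite mem_cycle_subspace => xA.
  have [ex|ex] := boolP (e \in supp x); last first.
    rewrite (subvP (addvSr _ _)) // mem_cycle_subspace cycles_delete //.
  rewrite -[x]addr0 -(ffunF2_addxx (chi C)) addrA addrC memv_add ?memv_line //.
  rewrite mem_cycle_subspace cycles_delete //.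
    move: ex; rewrite !inE negbK ffunE !ffunE eC => /negPf ex.
    by rewrite [x e]F2_bool ex /= F2_addxx.
  by rewrite -mem_cycle_subspace memvD // ?mem_cycle_subspace ?chiK.
apply: leq_trans (dimvS sub) (leq_trans (dimv_add_leqif _ _).1 _).
by rewrite dim_vline addnC; case: (chi C != 0); rewrite ?addn1 ?addn0.
Qed.

End Deletion.

Section FractionalBasis.
Variables (R : realFieldType) (G : multigraph) (k : nat).
Notation E := (edge G).
Variable N : {set {set {set E}}}.
Hypothesis k_large : (2 * \dim (cycle_space G) < 2 ^ k)%N.

(** Take a short cycle C, delete one of its l classes chosen uniformly at random,
continue in the rest, and add C to the resulting basis. The expected charge of an
edge outside C is an average of expected charges in smaller graphs. An edge of C
gets charge 1 from C, and with probability 1/l it is deleted and gets nothing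
else; so its expected charge is at most 1 + (1 - 1/l) L, which is at most L
because l is at most the bound L on the number of classes. The weight x C is the
probability that C belongs to the random basis. *)
Lemma fractional_cycle_basis (A : {set E}) :
  exists x : {set E} -> R,
    [/\ rounds N (@chi E) (cycle_subspace A) x, forall C, 0 <= x C,
        forall C, C \notin cycles A -> x C = 0
      & forall e, \sum_(C : {set E} | e \in C) x C <= k.*2.+1%:R].
Proof.
have [n] := ubnP #|A|; elim: n A => // n IHn A ltA.
have [K0|K0] := eqVneq (core A) set0.
  have Z0 : cycle_subspace A = 0%VS.
    apply/eqP; rewrite -subv0; apply/subvP=> x; rewrite mem_cycle_subspace memv0.
    by move/cycle_core; rewrite K0 subset0 -[x in x == 0]suppK => /eqP->;
      apply/eqP/ffunP=> e; rewrite !ffunE inE.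
  exists (indic R set0); split=> [|C|C _|e]; rewrite /indic ?inE //.
    apply: rounds_indic; rewrite /indexed_basis Z0.
    by rewrite (_ : [seq _ | _ in _] = [::]) ?nil_basis // /image_mem enum_set0.
  by rewrite big1 // => C _; rewrite inE.
have kA : (2 * \dim (cycle_subspace A) < 2 ^ k)%N.
  apply: leq_ltn_trans k_large; rewrite leq_mul2l /=; exact/dimvS/capvSl.
have [C CA [C0 Ck]] := short_cycle kA K0.
have CsA : C \subset A by move: CA; rewrite inE => /andP[].
pose P := trace A @: C.
have P0 : (0 < #|P|)%N.
  by have /set0Pn[e eC] := C0; apply/card_gt0P; exists (trace A e); apply: imset_f.
have /fin_all_exists[x xP] : forall t, exists x : {set E} -> R, t \in P ->
    [/\ rounds N (@chi E) (cycle_subspace (delete_class A t)) x, forall D, 0 <= x D,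
        forall D, D \notin cycles (delete_class A t) -> x D = 0
      & forall e, \sum_(D : {set E} | e \in D) x D <= k.*2.+1%:R].
  move=> t; have [tP|_] := boolP (t \in P); last by exists (fun=> 0).
  have [|x xP] := IHn (delete_class A t); last by exists x.
  apply: leq_trans (_ : #|A| <= n)%N => //; apply: proper_card; apply/properP.
  split; first by apply/subsetP=> f /setIdP[].
  have /imsetP[e eC ->] := tP; exists e; first exact: (subsetP CsA).
  by rewrite inE eqxx andbF.
pose s := enum P.
have sE t : (t \in s) = (t \in P) by rewrite mem_enum.
have sz : size s = #|P| by rewrite -cardE.
pose y t D := x t D + indic R [set C] D.
have y0 t D : t \in s -> 0 <= y t D.
  by rewrite sE => /xP[_ x0 _ _]; rewrite addr_ge0 ?ler0n.
exists (fun D => (size s)%:R^-1 * \sum_(t <- s) y t D); split.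
- apply: rounds_average => //; first by rewrite sz.
  move=> t; rewrite sE => tP; have [xR _ _ _] := xP t tP.
  have /imsetP[e eC te] := tP.
  by apply: rounds_setU1 xR _ => B; rewrite te => /(basis_delete CA eC).
- move=> D; rewrite mulr_ge0 ?invr_ge0 // big_seq sumr_ge0 // => t ts; exact: y0.
- move=> D DA; rewrite big_seq big1 ?mulr0 // => t; rewrite sE => tP.
  have [_ _ xD _] := xP t tP; rewrite /y xD; last first.
    by apply: contra DA; apply: (subsetP (cycles_deleteS _ _)).
  by rewrite /indic inE add0r; case: eqP => // DC; rewrite DC CA in DA.
move=> e; rewrite -mulr_sumr exchange_big /= ler_pdivrMl ?ltr0n ?sz //.
have loadE t : \sum_(D : {set E} | e \in D) y t D =
    \sum_(D : {set E} | e \in D) x t D + (e \in C)%:R.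
  rewrite big_split /=; congr (_ + _); case eC: (e \in C).
    rewrite (bigD1 C) //= /indic inE eqxx big1 ?addr0 // => D /andP[_ DC].
    by rewrite inE (negPf DC).
  by rewrite big1 // => D eD; rewrite /indic inE; case: eqP => // DC; rewrite DC eC in eD.
rewrite big_enum /= (eq_bigr _ (fun t _ => loadE t)).
case eC: (e \in C); last first.
  rewrite mulr_natl -sumr_const; apply: ler_sum => t tP.
  by rewrite addr0; have [_ _ _] := xP t tP; apply.
have tP : trace A e \in P by apply: imset_f.
rewrite big_split /= sumr_const (bigD1 _ tP) /= big1 => [|D eD]; last first.
  have [_ _ xD _] := xP _ tP; apply: xD; apply: contraTN eD => DA'.
  have DA := subsetP (cycles_deleteS _ _) _ DA'.
  by rewrite -(cycles_delete DA (subsetP CsA _ eC)).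
rewrite add0r; set L := k.*2.+1 in Ck xP *.
have le1 : \sum_(t in P | t != trace A e) \sum_(D : {set E} | e \in D) x t D <=
    (#|P|.-1 * L)%N%:R.
  apply: le_trans (_ : \sum_(t in P | t != trace A e) L%:R <= _).
    by apply: ler_sum => t /andP[tP' _]; have [_ _ _] := xP t tP'; apply.
  rewrite sumr_const -mulrnA ler_nat mulnC leq_mul2r.
  rewrite (cardsD1 (trace A e) P) tP /= (eq_card (B := P :\ trace A e)) ?leqnn ?orbT //.
  by move=> t; rewrite !inE andbC.
apply: le_trans (lerD le1 (lexx _)) _.
rewrite -natrD -natrM ler_nat -[X in (_ <= X * _)%N](prednK P0) mulSn addnC leq_add2r.
exact: Ck.
Qed.

End FractionalBasis.

(** Before rounding, 1 + x <= exp x bounds the term of every trace by exp of the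
expected charge; after rounding, the term of the trace of e alone is two to the
charge of e. The second alternative is for edges that lie on no cycle. *)
Lemma light_cycle_basis (R : realType) (G : multigraph) (k : nat) :
    (2 * cycle_rank G < 2 ^ k)%N ->
  exists2 B : {set {set edge G}}, cycle_basis B &
    forall e, 2 ^+ charge B e <= (7 * cycle_rank G)%:R * expR (k.*2.+1%:R : R)
      \/ charge B e = 0%N.
Proof.
move=> kG; pose N := trace setT @: core [set: edge G].
have [x [xR x0 xN load]] := fractional_cycle_basis R N kG setT.
have [||B bB leB] := xR 1 (fun=> 0) => //.
rewrite cycle_subspaceT in bB; exists B => // e.
have Bc C : C \in B -> C \in cycles setT.
  move=> CB; rewrite -chi_cycle_subspace cycle_subspaceT; apply: (basis_mem bB).
  by apply/imageP; exists C.
have [eK|eK] := boolP (e \in core setT); last first.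
  right; apply/eqP; rewrite cards_eq0; apply: contraNT eK => /set0Pn[C].
  by rewrite inE => /andP[CB eC]; apply/bigcupP; exists C => //; apply: Bc.
left; have tN : trace setT e \in N by apply: imset_f.
have lo : 2 ^+ charge B e <= potential N (fun i => 1 * indic R B i + 0).
  rewrite /potential (bigD1 _ tN) /= -[leLHS]addr0; apply: lerD; last first.
    by apply: sumr_ge0 => t _; apply: prodr_ge0 => i _; rewrite mul1r addr0 addr_ge0.
  rewrite /charge -prodr_const le_eqVlt; apply/orP; left; apply/eqP.
  rewrite big_mkcond [RHS]big_mkcond; apply: eq_bigr => C _.
  rewrite mul1r addr0 in_trace inE /indic.
  case CB: (C \in B); rewrite ?addr0 ?if_same //=.
  by rewrite Bc.
apply: le_trans lo (le_trans leB _).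
apply: le_trans (_ : \sum_(t in N) expR (k.*2.+1%:R : R) <= _).
  apply: ler_sum => t /imsetP[f _ ->].
  apply: le_trans (_ : expR (\sum_(i in trace setT f) x i) <= _).
    rewrite expR_sum; apply: ler_prod => i _; rewrite mul1r addr0 expR_ge1Dx.
    by rewrite addr_ge0.
  rewrite ler_expR; apply: le_trans (load f).
  rewrite [leLHS]big_mkcond [leRHS]big_mkcond; apply: ler_sum => C _.
  rewrite in_trace; case: (f \in C); rewrite ?andbF // andbT.
  by case: ifP.
rewrite sumr_const -[leLHS]mulr_natl ler_wpM2r ?expR_ge0 // ler_nat.
by have := traces_count [set: edge G]; rewrite cycle_subspaceT.
Qed.

(** Here l = ln 2, L = ln b, k is an exponent with 2 ^ (k - 1) <= 2b, and c is a
charge. *)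
Lemma log_arith (R : realFieldType) (l L c k : R) : 0 < l -> l <= L ->
    (k - 1) * l <= l + L -> c * l <= 3 * l + L + (2 * k + 1) ->
  c <= (4 + 7 / l) * (L / l).
Proof.
move=> l0 + + cL; have ln0 : l != 0 by rewrite gt_eqF.
have [q LE] : exists q, L = q * l by exists (L / l); rewrite divfK.
rewrite {}LE in cL *; rewrite mulfK // -[leLHS]mul1r ler_pM2r // => q1.
rewrite -[X in _ <= X + _]mul1r -mulrDl ler_pM2r // => k3.
rewrite -(ler_pM2r l0); apply: le_trans cL _.
rewrite (_ : _ * q * l = 4 * (q * l) + 7 * q); last by field.
have : 1 * l <= q * l by rewrite ler_pM2r.
by move: (q * l) => L'; lra.
Qed.

Theorem theorem1p2 (R : realType) :
  exists C : R, forall G : multigraph, (2 <= cycle_rank G)%N ->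
    (basis_number G)%:R <= C * log2 (cycle_rank G)%:R.
Proof.
pose l2 : R := ln 2.
have l20 : 0 < l2 by apply: ln_gt0; rewrite ltr1n.
exists (4 + 7 / l2) => G G2; set b := cycle_rank G in G2 *.
have b0 : 0 < b%:R :> R by rewrite ltr0n; apply: leq_trans G2.
pose L := ln b%:R : R; have L2 : l2 <= L by rewrite ler_ln ?posrE // (ler_nat R 2).
(* The least k to which the short cycle lemma applies. *)
pose m := trunc_log 2 (2 * b); pose k := m.+1.
have kG : (2 * b < 2 ^ k)%N by apply: trunc_log_ltn.
have kL : (k%:R - 1) * l2 <= l2 + L.
  rewrite -natr1 addrK.
  have : (2 ^ m)%N%:R <= (2 * b)%N%:R :> R.
    by rewrite ler_nat trunc_logP // muln_gt0 /=; apply: leq_trans G2.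
  rewrite -ler_ln ?posrE ?ltr0n ?expn_gt0 ?muln_gt0 //=; last exact: leq_trans G2.
  rewrite natrX natrM lnXn ?ltr0n // lnM ?posrE ?ltr0n //; last exact: leq_trans G2.
  by rewrite -[X in X <= _ -> _]mulr_natl.
have ln8 : ln 8 = 3 * l2 :> R.
  have -> : 8 = 2 ^+ 3 :> R by rewrite -(natrX R 2 3).
  by rewrite lnXn ?ltr0n // -[LHS]mulr_natl.
have [B bB chB] := light_cycle_basis R kG.
have bnB : (basis_number G <= congestion B)%N.
  rewrite /basis_number; case: ex_minnP => n _; apply.
  by apply/existsP; exists B; rewrite bB eqxx.
apply: (@le_trans _ _ (congestion B)%:R); first by rewrite ler_nat.
have X0 : 0 <= (4 + 7 / l2) * log2 b%:R.
  by rewrite mulr_ge0 ?addr_ge0 ?divr_ge0 ?(ltW l20) //; exact: le_trans (ltW l20) L2.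
rewrite /congestion; apply: (big_ind (fun m => m%:R <= (4 + 7 / l2) * log2 b%:R)) => //.
  by move=> m1 m2 le1 le2; case: (leqP m1 m2).
move=> e _; have [ch|->] := chB e; last exact: X0.
have : ln (2 ^+ charge B e) <= 3 * l2 + L + k.*2.+1%:R.
  (* 7 is replaced by 8 = 2 ^ 3 so that its logarithm is a multiple of ln 2. *)
  apply: le_trans (_ : ln (8 * b%:R * expR (k.*2.+1%:R : R)) <= _).
    rewrite ler_ln ?posrE ?exprn_gt0 ?mulr_gt0 ?expR_gt0 ?b0 //.
    apply: le_trans ch _; rewrite natrM ler_wpM2r ?expR_ge0 //.
    by rewrite ler_wpM2r ?ler0n // (ler_nat R 7 8).
  rewrite !lnM ?posrE ?mulr_gt0 ?expR_gt0 ?b0 // expRK.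
  by rewrite ln8 lexx.
rewrite lnXn ?ltr0n // -/l2 -[X in X <= _ -> _]mulr_natl => chl.
have kE : k.*2.+1%:R = 2 * k%:R + 1 :> R by rewrite -natr1 -muln2 natrM mulrC.
rewrite kE in chl.
exact: log_arith l20 L2 kL chl.
Qed.
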